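(* Let $\pi=\varinjlim\pi_n$ be a limit-aligned unitary representation of $G=\varinjlim G_n$. Suppose that the $\pi_n$ are multiplicity free. Then $\pi$ is multiplicity free. In other words the commuting algebra of $\pi$ is commutative.
   Context: $\{G_n\}$ is a direct system of topological groups, $G=\varinjlim G_n$. A direct limit unitary representation $\pi=\varinjlim\pi_n$ consists of unitary representations $\pi_n$ of $G_n$ on Hilbert spaces $V_{\pi_n}$ and $G_n$-equivariant isometric inclusions $V_{\pi_n}\hookrightarrow V_{\pi_{n+1}}$; $\pi$ is the representation of $G$ on the Hilbert space direct limit $V=\varinjlim V_{\pi_n}$ given by $\pi(g)v=\pi_n(g_n)v_n$ when $n$ is large enough that $g_n\in G_n$, $v_n\in V_{\pi_n}$ map to $g$, $v$. A unitary representation $\pi$ of $G$ is *limit-aligned* if it is a direct limit $\varinjlim\pi_n$ of unitary representations in such a way that (i) each group $G_n$ is of type I, (ii) $\pi_n$ is a continuous direct sum (direct integral) $\int\zeta_n\,d\nu_n(\zeta_n)$ of mutually disjoint primary representations, and (iii) the corresponding inclusions $V_{\pi_n}=\int V_{\zeta_n}\,d\nu_n(\zeta_n)\hookrightarrow\int V_{\zeta_{n+1}}\,d\nu_{n+1}(\zeta_{n+1})=V_{\pi_{n+1}}$ of representation spaces map $\nu_n$-almost every primary integrand $V_{\zeta_n}$ of $V_{\pi_n}$ into a primary integrand $V_{\zeta_{n+1}}$ of $V_{\pi_{n+1}}$. A unitary representation is multiplicity free if its commuting algebra (the algebra of bounded operators commuting with it) is commutative. *)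

(* Defs.v *)
From HB Require Import structures.
From mathcomp Require Import all_boot all_order all_algebra.
From mathcomp Require Import all_classical all_reals all_analysis.
From mathcomp Require Import complex.

Set Implicit Arguments.
Unset Strict Implicit.
Unset Printing Implicit Defensive.

Import Order.TTheory GRing.Theory Num.Theory.
Import numFieldNormedType.Exports.

Local Open Scope classical_set_scope.
Local Open Scope ring_scope.
Local Open Scope complex_scope.

HB.mixin Record Group_isTopologicalGroup G of Group G & Topological G := {
  mulg_continuous : continuous (fun x : G * G => (x.1 * x.2)%g) ;
  invg_continuous : continuous (fun x : G => (x^-1)%g)
}.

#[short(type="topologicalGroupType")]
HB.structure Definition TopologicalGroup :=
  {G of Group G & Topological G & Group_isTopologicalGroup G}.

Definition continuous_hom (G H : topologicalGroupType) (f : G -> H) : Prop :=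
  {morph f : x y / (x * y)%g} /\ continuous f.

Record groupSystem := GroupSystem {
  gs_group :> nat -> topologicalGroupType ;
  gs_map : forall n, gs_group n -> gs_group n.+1 ;
  gs_hom : forall n, continuous_hom (@gs_map n)
}.

Definition compatible (Gs : groupSystem) (H : topologicalGroupType)
    (f : forall n, Gs n -> H) : Prop :=
  (forall n, continuous_hom (f n)) /\
  (forall n g, f n.+1 (gs_map g) = f n g).

(** [G], with the canonical maps [phi], is the direct limit of [Gs] in the
    category of topological groups. *)
Definition is_group_limit (Gs : groupSystem) (G : topologicalGroupType)
    (phi : forall n, Gs n -> G) : Prop :=
  compatible phi /\
  forall (H : topologicalGroupType) (f : forall n, Gs n -> H),
    compatible f ->
    exists! F : G -> H, continuous_hom F /\ forall n g, F (phi n g) = f n g.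

(** The inner product is linear in its first argument. *)
Record hilbert (R : realType) := Hilbert {
  hilbert_sort :> completeNormedModType R[i] ;
  inner : {dot hilbert_sort for Num.conj} ;
  inner_norm : forall v : hilbert_sort, `|v| ^+ 2 = inner v v
}.

Notation "⟪ u , v ⟫" := (inner _ u v) (format "⟪ u ,  v ⟫").

Definition isometric (R : realType) (V W : hilbert R)
    (T : {linear V -> W}) : Prop :=
  forall u v : V, ⟪T u, T v⟫ = ⟪u, v⟫.

Definition lspan (R : realType) (V : hilbert R) (A : set V) : set V :=
  [set v | exists n (c : 'I_n -> R[i]) (a : 'I_n -> V),
    (forall k, A (a k)) /\ v = \sum_(k < n) c k *: a k].

Record unirep (R : realType) (G : topologicalGroupType) (V : hilbert R) :=
UniRep {
  rep :> G -> {linear V -> V} ;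
  rep1 : forall v, rep 1%g v = v ;
  repM : forall g h v, rep (g * h)%g v = rep g (rep h v) ;
  rep_isometric : forall g, isometric (rep g) ;
  rep_continuous : forall v, continuous (fun g => rep g v)
}.

Section Representations.
Variables (R : realType) (G : topologicalGroupType).

Definition intertwines (V W : hilbert R) (pi : unirep G V) (rho : unirep G W)
    (T : {linear V -> W}) : Prop :=
  forall g v, T (pi g v) = rho g (T v).

(** Continuous linear operators are the same as bounded ones
    ([linear_bounded_continuous]). *)
Definition commuting_algebra (V : hilbert R) (pi : unirep G V) :
    set {linear V -> V} :=
  [set T : {linear V -> V} | continuous T /\ intertwines pi pi T].

Definition multiplicity_free (V : hilbert R) (pi : unirep G V) : Prop :=
  forall S T : {linear V -> V},
    commuting_algebra pi S -> commuting_algebra pi T ->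
    forall v, S (T v) = T (S v).

Definition primary (V : hilbert R) (pi : unirep G V) : Prop :=
  (exists v : V, v != 0) /\
  forall T : {linear V -> V},
    commuting_algebra pi T ->
    (forall S : {linear V -> V}, commuting_algebra pi S ->
       forall v, S (T v) = T (S v)) ->
    exists c : R[i], forall v, T v = c *: v.

Definition irreducible (V : hilbert R) (pi : unirep G V) : Prop :=
  (exists v : V, v != 0) /\
  forall W : set V,
    W 0 -> (forall (a : R[i]) u v, W u -> W v -> W (a *: u + v)) ->
    closed W -> (forall g v, W v -> W (pi g v)) ->
    W = [set 0] \/ W = setT.

(** No nonzero representation is equivalent both to a subrepresentation of
    [pi] and to a subrepresentation of [rho]. *)
Definition disjoint_reps (V W : hilbert R) (pi : unirep G V)
    (rho : unirep G W) : Prop :=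
  forall (E : hilbert R) (tau : unirep G E)
    (T : {linear E -> V}) (S : {linear E -> W}),
    isometric T -> intertwines tau pi T ->
    isometric S -> intertwines tau rho S ->
    forall x : E, x = 0.

(** [pi] is a Hilbert space direct sum of copies of one irreducible
    representation. *)
Definition multiple_of_irreducible (V : hilbert R) (pi : unirep G V) : Prop :=
  exists (E : hilbert R) (sigma : unirep G E), irreducible sigma /\
  exists (I : Type) (T : I -> {linear E -> V}),
    [/\ forall i, isometric (T i),
        forall i, intertwines sigma pi (T i),
        forall i k x y, i <> k -> ⟪T i x, T k y⟫ = 0
      & dense (lspan (\bigcup_i range (T i)))].

End Representations.

Definition type_I (R : realType) (G : topologicalGroupType) : Prop :=
  forall (V : hilbert R) (pi : unirep G V),
    primary pi -> multiple_of_irreducible pi.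

Section ComplexIntegral.
Context {R : realType} d {X : measurableType d}.

Definition cmeasurable (f : X -> R[i]) : Prop :=
  measurable_fun setT (fun x => complex.Re (f x)) /\
  measurable_fun setT (fun x => complex.Im (f x)).

Definition cintegrable (mu : {measure set X -> \bar R}) (f : X -> R[i]) :
    Prop :=
  mu.-integrable setT (fun x => (complex.Re (f x))%:E) /\
  mu.-integrable setT (fun x => (complex.Im (f x))%:E).

Definition cintegral (mu : {measure set X -> \bar R}) (f : X -> R[i]) : R[i] :=
  (\int[mu]_x complex.Re (f x)) +i* (\int[mu]_x complex.Im (f x)).

End ComplexIntegral.

(** A measurable field of Hilbert spaces is given by a fundamental sequence of
    sections; in particular the fibers are separable. *)
Record hilbertField (R : realType) d (X : measurableType d) := HilbertField {
  fiber :> X -> hilbert R ;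
  fund : nat -> forall x, fiber x ;
  fund_measurable :
    forall j k, cmeasurable (fun x => ⟪fund j x, fund k x⟫) ;
  fund_total : forall x, dense (lspan (range (fund ^~ x)))
}.

Section DirectIntegral.
Context (R : realType) d (X : measurableType d).
Variable H : hilbertField R X.

Definition measurable_section (s : forall x, H x) : Prop :=
  forall j, cmeasurable (fun x => ⟪s x, fund H j x⟫).

Definition l2_section (mu : {measure set X -> \bar R}) (s : forall x, H x) :
    Prop :=
  measurable_section s /\
  (\int[mu]_x (complex.Re ⟪s x, s x⟫)%:E < +oo)%E.

Record repField (G : topologicalGroupType) := RepField {
  field_rep :> forall x, unirep G (H x) ;
  field_rep_measurable : forall g s, measurable_section s ->
    measurable_section (fun x => field_rep x g (s x))
}.

(** [Phi v] is a representative of the class of square integrable sections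
    that corresponds to [v]. *)
Record is_direct_integral (mu : {measure set X -> \bar R})
    (G : topologicalGroupType) (zeta : repField G)
    (V : hilbert R) (pi : unirep G V) (Phi : V -> forall x, H x) : Prop :=
IsDirectIntegral {
  di_l2 : forall v, l2_section mu (Phi v) ;
  di_linear : forall (a : R[i]) v w,
    {ae mu, forall x, Phi (a *: v + w) x = a *: Phi v x + Phi w x} ;
  di_inner : forall v w,
    ⟪v, w⟫ = cintegral mu (fun x => ⟪Phi v x, Phi w x⟫) ;
  di_surj : forall s, l2_section mu s ->
    exists v, {ae mu, forall x, Phi v x = s x} ;
  di_rep : forall g v,
    {ae mu, forall x, Phi (pi g v) x = zeta x g (Phi v x)}
}.

End DirectIntegral.

Record primary_decomposition (R : realType) (G : topologicalGroupType)
    (V : hilbert R) (pi : unirep G V) := PrimaryDecomposition {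
  pd_disp : measure_display ;
  pd_space : measurableType pd_disp ;
  pd_measure : {measure set pd_space -> \bar R} ;
  pd_field : hilbertField R pd_space ;
  pd_rep : repField pd_field G ;
  pd_iso : V -> forall x, pd_field x ;
  pd_isoP : is_direct_integral pd_measure pd_rep pi pd_iso ;
  pd_primary : {ae pd_measure, forall x, primary (pd_rep x)} ;
  pd_disjoint : exists N : set pd_space, pd_measure.-negligible N /\
    forall x y, ~ N x -> ~ N y -> x <> y -> disjoint_reps (pd_rep x) (pd_rep y)
}.

(** [J] maps the integrand at [x] into the integrand at [p x], through the
    bounded operator [iota x].  A single integrand need not be a subspace of the
    direct integral, so this means that [J] is assembled from the [iota x],
    i.e. [J s] is the integral of the vectors [iota x (s x)]: weakly,
    [⟪J s, t⟫] is the integral of [⟪iota x (s x), t (p x)⟫].  The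
    Radon-Nikodym factors that compare the two measures are part of [iota],
    whose values are thus almost everywhere multiples of isometries, and [p] need not be
    injective.  The sections [s] and [t] range over all representatives, so
    that null sets of the target carry no integrand. *)
Definition preserves_integrands (R : realType) (G G' : topologicalGroupType)
    (V V' : hilbert R) (pi : unirep G V) (pi' : unirep G' V')
    (D : primary_decomposition pi) (D' : primary_decomposition pi')
    (J : {linear V -> V'}) : Prop :=
  exists (p : pd_space D -> pd_space D')
    (iota : forall x, {linear pd_field D x -> pd_field D' (p x)}),
    (forall x, continuous (iota x)) /\
    forall v w (s : forall x, pd_field D x) (t : forall y, pd_field D' y),
      l2_section (pd_measure D) s ->
      {ae pd_measure D, forall x, pd_iso v x = s x} ->
      l2_section (pd_measure D') t ->
      {ae pd_measure D', forall y, pd_iso w y = t y} ->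
      let f x := ⟪iota x (s x), t (p x)⟫ in
      cintegrable (pd_measure D) f /\
      ⟪J v, w⟫ = cintegral (pd_measure D) f.

Record repSystem (R : realType) (Gs : groupSystem) := RepSystem {
  rs_space : nat -> hilbert R ;
  rs_rep : forall n, unirep (Gs n) (rs_space n) ;
  rs_map : forall n, {linear rs_space n -> rs_space n.+1} ;
  rs_isometric : forall n, isometric (rs_map n) ;
  rs_equivariant : forall n g v,
    rs_map n (rs_rep n g v) = rs_rep n.+1 (gs_map g) (rs_map n v)
}.

(** [V], with the canonical maps [j], is the Hilbert space direct limit of the
    spaces of [P], and [pi] is the limit representation on it. *)
Record is_rep_limit (R : realType) (Gs : groupSystem)
    (G : topologicalGroupType) (phi : forall n, Gs n -> G)
    (P : repSystem R Gs) (V : hilbert R) (pi : unirep G V)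
    (j : forall n, {linear rs_space P n -> V}) : Prop := IsRepLimit {
  rl_isometric : forall n, isometric (j n) ;
  rl_compatible : forall n v, j n.+1 (rs_map P n v) = j n v ;
  rl_dense : dense (\bigcup_n range (j n)) ;
  rl_rep : forall n g v, pi (phi n g) (j n v) = j n (rs_rep P n g v)
}.

Definition limit_aligned (R : realType) (Gs : groupSystem)
    (P : repSystem R Gs) : Prop :=
  (forall n, type_I R (Gs n)) /\
  exists D : forall n, primary_decomposition (rs_rep P n),
    forall n, preserves_integrands (D n) (D n.+1) (rs_map P n).

(* Main.v *)
(** Let [A n] be the adjoint of the inclusion [j n].  If [T] commutes with [pi],
    its compression [A n T (j n)] commutes with [pi_n], because [j n] is
    equivariant; so the compressions of [S] and [T] commute with each other.
    The ranges of the [j n] increase to a dense subspace, hence the projections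
    [(j n) (A n)] converge strongly to the identity, and the two orders of the
    product of the compressions converge strongly to [S T] and [T S]. *)

From HB Require Import structures.
Require Import Defs.
From mathcomp Require Import all_boot all_order all_algebra.
From mathcomp Require Import all_classical all_reals all_analysis.
From mathcomp Require Import complex ring lra.

Import Order.TTheory GRing.Theory Num.Theory.
Import numFieldNormedType.Exports.

Local Open Scope classical_set_scope.
Local Open Scope ring_scope.
Local Open Scope complex_scope.

(** * Real-valued norms and inner product identities *)

Section RealNorm.
Context {R : realType} {V : hilbert R}.
Implicit Types x y : V.

(** The norm takes values in [R[i]]; its real part lives in an ordered field with infima, where
    [nra] and [lra] apply. *)
Definition rnorm x : R := complex.Re `|x|.

Lemma rnormE x : `|x| = (rnorm x)%:C.
Proof. by rewrite /rnorm RRe_real// ger0_real. Qed.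

Lemma rnorm_ge0 x : 0 <= rnorm x.
Proof. by rewrite -(lecR 0) -rnormE normr_ge0. Qed.

Lemma ler_rnormB x y z : rnorm (x - z) <= rnorm (x - y) + rnorm (y - z).
Proof. by rewrite -lecR rmorphD/= -!rnormE; exact: ler_distD. Qed.

Lemma rnormZ (a : R) x : 0 <= a -> rnorm (a%:C *: x) = a * rnorm x.
Proof.
move=> a0; apply: complexI.
by rewrite rmorphM/= -!rnormE normrZ ger0_norm// lecR.
Qed.

(* Restates [linearBl], and below [linearPl], so that both sides keep the
   coercion path of [inner]. *)
Lemma innerBl x y z : ⟪x - y, z⟫ = ⟪x, z⟫ - ⟪y, z⟫.
Proof. exact: linearBl. Qed.

Lemma innerPl a x y z : ⟪a *: x + y, z⟫ = a * ⟪x, z⟫ + ⟪y, z⟫.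
Proof. exact: linearPl. Qed.

Lemma inner_ext x y : (forall z, ⟪x, z⟫ = ⟪y, z⟫) -> x = y.
Proof.
move=> xy; apply/eqP; rewrite -subr_eq0 -(dnorm_eq0 (@inner _ V)).
have : ⟪x - y, x - y⟫ = 0 by rewrite innerBl xy subrr.
by move=> ->.
Qed.

Lemma inner_sym x y : ⟪x, y⟫ = (⟪y, x⟫^*)%R.
Proof. by rewrite hermC expr0 mul1r. Qed.

Lemma inner_rnorm x : ⟪x, x⟫ = (rnorm x ^+ 2)%:C.
Proof. by rewrite -inner_norm rnormE rmorphXn. Qed.

Lemma parallelogram x y :
  rnorm (x - y) ^+ 2 + rnorm (x + y) ^+ 2 =
  2 * (rnorm x ^+ 2 + rnorm y ^+ 2).
Proof.
apply: complexI; rewrite rmorphM !rmorphD/= -!inner_rnorm dnormB dnormD/=.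
rewrite rmorph1; ring.
Qed.

End RealNorm.

(** * The adjoint of an isometry, via nearest points *)

Section Adjoint.
Context {R : realType} {W V : hilbert R} (J : {linear W -> V}).
Hypothesis isoJ : isometric J.

Lemma isometric_rnorm w : rnorm (J w) = rnorm w.
Proof.
apply/eqP; rewrite -(@eqrXn2 _ 2) ?rnorm_ge0//; apply/eqP/complexI.
by rewrite -!inner_rnorm.
Qed.

Lemma isometric_norm w : `|J w| = `|w|.
Proof. by rewrite !rnormE isometric_rnorm. Qed.

(* Minimizing sequences are Cauchy by the parallelogram law. *)
Lemma nearest_point v : exists u, forall w, rnorm (v - J u) <= rnorm (v - J w).
Proof.
pose E := [set rnorm (v - J w) | w in [set: W]].
have lbE : lbound E 0 by move=> _ [w _ <-]; exact: rnorm_ge0.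
have infE : has_inf E.
  by split; [exists (rnorm (v - J 0)), 0 | exists 0].
pose d := inf E.
have d_le w : d <= rnorm (v - J w).
  by apply: ge_inf; [exists 0 | exists w].
have d0 : 0 <= d by apply: lb_le_inf => //; case: infE.
(* The midpoint of [w] and [w'] has an image at distance at least [d] from [v], so the parallelogram
   law leaves 4(d + e)^2 - 4d^2. *)
have close w w' (e : R) : 0 < e -> rnorm (v - J w) <= d + e ->
    rnorm (v - J w') <= d + e -> rnorm (w - w') ^+ 2 <= 4 * e * (2 * d + e).
  move=> e0 we w'e.
  have := parallelogram (v - J w') (v - J w).
  have -> : v - J w' - (v - J w) = J (w - w').
    by rewrite (linearB J) opprB addrC addrA subrK.
  have -> : v - J w' + (v - J w) =
      2%:C *: (v - J (2^-1%:C *: (w' + w))).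
    rewrite linearZ scalerBr scalerA -rmorphM/= divff ?pnatr_eq0// scale1r.
    by rewrite rmorphMn/= rmorph1 scaler_nat mulr2n linearD opprD addrACA.
  rewrite rnormZ// isometric_rnorm.
  have := d_le (2^-1%:C *: (w' + w)).
  move: (rnorm_ge0 (v - J w)) (rnorm_ge0 (v - J w')) we w'e.
  set a := rnorm _; set b := rnorm _; set c := rnorm (v - _).
  set r := rnorm _.
  move=> a0 b0 ad bd dc eq.
  have : a ^+ 2 <= (d + e) ^+ 2 by rewrite lerXn2r ?nnegrE// addr_ge0// ltW.
  have : b ^+ 2 <= (d + e) ^+ 2 by rewrite lerXn2r ?nnegrE// addr_ge0// ltW.
  have : d ^+ 2 <= c ^+ 2 by rewrite lerXn2r ?nnegrE// (le_trans d0).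
  nra.
have /choice[u uP] n : exists w, rnorm (v - J w) < d + n.+1%:R^-1.
  have [|_ [w _ <-] wd] := @inf_adherent _ E n.+1%:R^-1 _ infE.
    by rewrite invr_gt0.
  by exists w.
have unear (e : R) : 0 < e -> \forall n \near \oo, rnorm (v - J (u n)) <= d + e.
  move=> e0; have := near_infty_natSinv_lt (PosNum e0).
  apply: filterS => n /= ne; apply: ltW; apply: lt_trans (uP n) _.
  by rewrite ltrD2l.
have cu : cvg (u @ \oo).
  apply/cauchy_cvgP/cauchy_exP => eps eps0.
  have epsE : eps = (complex.Re eps)%:C by rewrite RRe_real// gtr0_real.
  move: eps0; rewrite {}epsE; move: (complex.Re eps) => r.
  rewrite (ltcR 0) => r0.
  (* As [e <= 1], the bound of [close] is at most 4e(2d + 1), which is below 16e(d + 1) and hence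
     below [r ^+ 2]. *)
  pose e := Num.min 1 (r ^+ 2 / (16 * (d + 1))).
  have den0 : 0 < 16 * (d + 1) by nra.
  have e0 : 0 < e by rewrite lt_min ltr01 divr_gt0// exprn_gt0.
  have e1 : e <= 1 by rewrite ge_min lexx.
  have er : e * (16 * (d + 1)) <= r ^+ 2.
    by rewrite -ler_pdivlMr// ge_min lexx orbT.
  have [N _ NP] := unear _ e0.
  exists (u N); exists N => // n /= Nn.
  rewrite -ball_normE /ball_/= rnormE ltcR.
  have := close _ _ _ e0 (NP N (leqnn N)) (NP n Nn).
  have := rnorm_ge0 (u N - u n).
  set a := rnorm _ => a0 le.
  rewrite ltNge; apply/negP => ra.
  have : r ^+ 2 <= a ^+ 2 by rewrite lerXn2r ?nnegrE// ltW.
  nra.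
(* The limit attains [d]: a term [u n] contributes [d + e / 2], and [J] preserves its distance to
   the limit, below [e / 2]. *)
exists (lim (u @ \oo)) => w; apply: le_trans (d_le w).
apply/ler_addgt0Pr => e e0.
have e2 : 0 < e / 2 by rewrite divr_gt0.
have [n []] : exists n, rnorm (v - J (u n)) <= d + e / 2 /\
    `|lim (u @ \oo) - u n| < (e / 2)%:C.
  have e2C : 0 < (e / 2)%:C by rewrite (ltcR 0).
  have /cvgrPdist_lt/(_ _ e2C) near := cu.
  have [n] := filter_ex (filterI (unear _ e2) near).
  by exists n.
move=> dn; rewrite rnormE ltcR => un.
apply: le_trans (ler_rnormB _ (J (u n)) _) _.
rewrite -linearB isometric_rnorm.
have -> : rnorm (u n - lim (u @ \oo)) = rnorm (lim (u @ \oo) - u n).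
  by rewrite /rnorm distrC.
by move: dn un; lra.
Qed.

Lemma nearest_point_orthogonal v u :
  (forall w, rnorm (v - J u) <= rnorm (v - J w)) ->
  forall w, ⟪v - J u, J w⟫ = 0.
Proof.
move=> umin w; set x := v - J u; set c := ⟪x, J w⟫.
have [w0|w0] := eqVneq w 0; first by rewrite /c w0 !linear0.
have nw0 : 0 < ⟪w, w⟫ by rewrite dnorm_gt0.
(* Moving [u] by [t *: w] with this optimal [t] lowers the squared distance by |c|^2 / ⟪w, w⟫, so
   minimality forces [c] to vanish. *)
pose t := c / ⟪w, w⟫.
have : ⟪x, x⟫ <= ⟪x - t *: J w, x - t *: J w⟫.
  rewrite !inner_rnorm lecR lerXn2r ?nnegrE ?rnorm_ge0//.
  have -> : x - t *: J w = v - J (u + t *: w).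
    by rewrite (linearD J) [J (t *: w)]linearZ opprD addrA.
  exact: umin.
clearbody x; rewrite dnormB dnormZ linearZr/= -/c isoJ.
rewrite -addrA lerDl subr_ge0.
set q := `|c| ^+ 2 / ⟪w, w⟫.
have tc : (t^* * c)%R = q.
  rewrite /t rmorphM/= fmorphV/= (conj_Creal (gtr0_real nw0)).
  by rewrite mulrAC [(_^* * _)%R]mulrC -normCK.
have q0 : 0 <= q by rewrite divr_ge0 ?exprn_ge0// ltW.
rewrite tc (conj_Creal (ger0_real q0)).
have -> : `|t| ^+ 2 * ⟪w, w⟫ = q.
  rewrite /q /t normrM normfV (gtr0_norm nw0). field.
  by rewrite gt_eqF.
rewrite gerDl pmulr_lle0 ?invr_gt0//.
by move=> c0; apply/eqP; rewrite -normr_eq0 -sqrf_eq0 eq_le c0 exprn_ge0.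
Qed.

(** [A v] is the [u] whose image is nearest to [v]; orthogonality of [v - J u] to the range of [J]
    is the adjoint relation, which determines [A v] and so makes [A] linear. *)
Lemma adjoint_exists :
  exists A : {linear V -> W}, forall v w, ⟪A v, w⟫ = ⟪v, J w⟫.
Proof.
have /choice[A AP] v : exists u, forall w, ⟪u, w⟫ = ⟪v, J w⟫.
  have [u umin] := nearest_point v; exists u => w.
  have /eqP := nearest_point_orthogonal _ _ umin w.
  by rewrite innerBl subr_eq0 isoJ => /eqP.
have linA : linear A.
  by move=> a x y; apply: inner_ext => w; rewrite innerPl !AP innerPl.
pose mixA := GRing.isLinear.Build _ _ _ _ A linA.
pose lA : {linear V -> W} := HB.pack A mixA.
by exists lA.
Qed.

Variable A : {linear V -> W}.
Hypothesis adjA : forall v w, ⟪A v, w⟫ = ⟪v, J w⟫.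

Lemma isometric_adjointK w : A (J w) = w.
Proof. by apply: inner_ext => z; rewrite adjA isoJ. Qed.

(** [J \o A] is the orthogonal projection onto the range of [J], so [v] splits into orthogonal
    summands. *)
Lemma pythagoras_adjoint v :
  rnorm v ^+ 2 = rnorm (A v) ^+ 2 + rnorm (v - J (A v)) ^+ 2.
Proof.
apply: complexI; rewrite rmorphD/= -!inner_rnorm -[⟪A v, A v⟫]isoJ.
set p := J (A v); have vE : v = p + (v - p) by rewrite addrC subrK.
have pv : ⟪p, v - p⟫ = 0.
  by rewrite inner_sym innerBl -adjA isoJ subrr rmorph0.
by rewrite {1 2}vE; exact: hnormDd.
Qed.

Lemma adjoint_norm_le v : `|A v| <= `|v|.
Proof.
rewrite !rnormE lecR -(@ler_pXn2r _ 2) ?nnegrE ?rnorm_ge0//.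
by rewrite (pythagoras_adjoint v) lerDl sqr_ge0.
Qed.

(** The projection fixes [J w], so [v] and [v - J w] have the same residual, and a residual is no
    longer than its vector. *)
Lemma adjoint_best_approximation v w : `|v - J (A v)| <= `|v - J w|.
Proof.
have -> : v - J (A v) = (v - J w) - J (A (v - J w)).
  by rewrite (linearB A) isometric_adjointK (linearB J) opprB addrA subrK.
rewrite !rnormE lecR -(@ler_pXn2r _ 2) ?nnegrE ?rnorm_ge0//.
by rewrite (pythagoras_adjoint (v - J w)) lerDr sqr_ge0.
Qed.

End Adjoint.

Lemma contraction_continuous {R : realType} {V W : hilbert R}
    (T : {linear V -> W}) : (forall v, `|T v| <= `|v|) -> continuous T.
Proof.
move=> T1 v; apply/cvgrPdist_lt => e e0.
have /cvgrPdist_lt/(_ _ e0) : (x @[x --> v] --> v) by exact: cvg_id.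
by apply: filterS => x; apply: le_lt_trans; rewrite -linearB.
Qed.

(** * Compressions of commuting operators *)

Section Compression.
Context {R : realType} {G H : topologicalGroupType} (f : H -> G).
Context {V W : hilbert R} (pi : unirep G V) (rho : unirep H W).
Variables (J : {linear W -> V}) (A : {linear V -> W}).
Hypothesis isoJ : isometric J.
Hypothesis adjA : forall v w, ⟪A v, w⟫ = ⟪v, J w⟫.
Hypothesis eqvJ : forall h w, pi (f h) (J w) = J (rho h w).

(** Every test vector has the form [rho h w'], and then unitarity cancels [h] on both sides. *)
Lemma adjoint_equivariant h v : A (pi (f h) v) = rho h (A v).
Proof.
apply: inner_ext => w.
have -> : w = rho h (rho h^-1%g w) by rewrite -repM mulgV rep1.
by rewrite adjA -eqvJ !rep_isometric adjA.
Qed.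

Lemma compression_commuting_algebra (T : {linear V -> V}) :
  commuting_algebra pi T -> commuting_algebra rho (A \o T \o J).
Proof.
move=> [cT piT]; split; last first.
  by move=> h w /=; rewrite -eqvJ piT adjoint_equivariant.
have cA := contraction_continuous _ (adjoint_norm_le _ isoJ _ adjA).
have cJ : continuous J.
  by apply: contraction_continuous => w; rewrite isometric_norm.
move=> w; apply: continuous_comp; first exact: cJ.
by apply: continuous_comp; [exact: cT | exact: cA].
Qed.

End Compression.

(** * Strong convergence along the direct limit *)

Section Limit.
Context {R : realType} {Gs : groupSystem} {G : topologicalGroupType}.
Context {phi : forall n, Gs n -> G} {P : repSystem R Gs} {V : hilbert R}.
Variables (pi : unirep G V) (j : forall n, {linear rs_space P n -> V}).
Hypothesis lim_j : is_rep_limit phi pi j.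
Variable A : forall n, {linear V -> rs_space P n}.
Hypothesis adjA : forall n v w, ⟪A n v, w⟫ = ⟪v, j n w⟫.

Lemma range_nondecreasing n m : (n <= m)%N -> range (j n) `<=` range (j m).
Proof.
move=> /subnK <-; elim: (m - n)%N => [//|k IH] v /IH[w _ <-].
by exists (rs_map P (k + n)%N w); rewrite // (rl_compatible lim_j).
Qed.

(** By density some range contains a point within [e] of [v]; all later ranges contain it too, and
    their projections of [v] are at least as close. *)
Lemma projection_cvg v : j n (A n v) @[n --> \oo] --> v.
Proof.
apply/cvgrPdist_lt => e e0.
have [x [vx [n _ [u _ ux]]]] : (ball v e `&` \bigcup_n range (j n)) !=set0.
  apply: (rl_dense lim_j); last exact: ball_open.
  by exists v; exact: ballxx.
exists n => // m /= nm.
have [w _ wx] : range (j m) x by apply: (range_nondecreasing _ _ nm); exists u.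
have isom : isometric (j m) by exact: (rl_isometric lim_j).
apply: le_lt_trans (adjoint_best_approximation _ isom _ (adjA m) v w) _.
by move: vx; rewrite wx -ball_normE.
Qed.

(** The projections are contractions, so they send the error [u n - v] to a null sequence; this lets
    strong limits pass through products. *)
Lemma projection_cvg_seq (u : nat -> V) (v : V) :
  (u n @[n --> \oo] --> v) -> (j n (A n (u n)) @[n --> \oo] --> v).
Proof.
move=> uv.
have -> : (fun n => j n (A n (u n))) =
    (fun n => j n (A n (u n - v)) + j n (A n v)).
  by apply/funext => n; rewrite -linearD -linearD subrK.
rewrite -[X in _ --> X]add0r; apply: cvgD; last exact: projection_cvg.
apply/cvgrPdist_lt => e e0; move/cvgrPdist_lt/(_ _ e0): uv.
apply: filterS => n; apply: le_lt_trans.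
have isom : isometric (j n) by exact: (rl_isometric lim_j).
rewrite sub0r normrN (isometric_norm _ isom) distrC.
exact: adjoint_norm_le isom _ (adjA n) _.
Qed.

(** With Q the projection [j n \o A n], the left side is Q S Q T Q [v]; the limit is taken one
    factor at a time, from the inside. *)
Lemma compression_comp_cvg (S T : {linear V -> V}) v :
  continuous S -> continuous T ->
  j n ((A n \o S \o j n) ((A n \o T \o j n) (A n v))) @[n --> \oo] -->
  S (T v).
Proof.
move=> cS cT /=.
apply: projection_cvg_seq; apply: continuous_cvg; first exact: cS.
apply: projection_cvg_seq; apply: continuous_cvg; first exact: cT.
exact: projection_cvg.
Qed.

End Limit.

Theorem theorem2p2 (R : realType) (Gs : groupSystem)
    (G : topologicalGroupType) (phi : forall n : nat, Gs n -> G)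
    (P : repSystem R Gs) (V : hilbert R) (pi : unirep G V)
    (j : forall n : nat, {linear rs_space P n -> V}) :
  is_group_limit phi ->
  is_rep_limit phi pi j ->
  limit_aligned P ->
  (forall n : nat, multiplicity_free (rs_rep P n)) ->
  multiplicity_free pi.
Proof.
move=> _ lim_j _ mf S T [cS piS] [cT piT] v.
have isom n : isometric (j n) by exact: (rl_isometric lim_j).
pose A n := sval (cid (adjoint_exists _ (isom n))).
have adjA n : forall v w, ⟪A n v, w⟫ = ⟪v, j n w⟫.
  by rewrite /A; case: cid.
have ST := compression_comp_cvg _ _ lim_j A adjA S T v cS cT.
have TS := compression_comp_cvg _ _ lim_j A adjA T S v cT cS.
apply: (cvg_unique (@norm_hausdorff _ V) ST).
(* The two sequences agree term by term, since at each level the compressions of [S] and [T] lie in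
   a commutative commuting algebra. *)
apply: cvg_trans TS; apply: near_eq_cvg; apply: nearW => n; congr (j n _).
have eqv g w : pi (phi n g) (j n w) = j n (rs_rep P n g w).
  exact: (rl_rep lim_j).
by apply: mf; apply: compression_commuting_algebra => //; exact: eqv.
Qed.
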